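(* Let $G$ be a commutative multiplicative hyperring with identity $1$, let $A$ be a $\mathcal{C}$-hyperideal of $G$ and let $S$ be a multiplicative closed subset of $G$ such that $A\cap S=\varnothing$. Then $A$ is a quasi $S$-primary hyperideal of $G$ if and only if $\mathrm{rad}(A)$ is an $S$-prime hyperideal of $G$.
   Context: A commutative multiplicative hyperring with identity is a triple $(G,+,\circ)$ where $(G,+)$ is an abelian group and $\circ$ assigns to each pair $(x,y)\in G\times G$ a non-empty subset $x\circ y\subseteq G$, such that for all $x,y,z\in G$: $(x\circ y)\circ z=x\circ(y\circ z)$; $(-x)\circ y=x\circ(-y)=-(x\circ y)$; $(y+z)\circ x\subseteq y\circ x+z\circ x$ and $x\circ(y+z)\subseteq x\circ y+x\circ z$; $x\circ y=y\circ x$; and there is $1\in G$ with $a\in 1\circ a$ for all $a\in G$. For non-empty subsets $X,Y\subseteq G$, $X\circ Y=\bigcup_{x\in X,y\in Y}x\circ y$ and $X+Y=\{x+y: x\in X,y\in Y\}$; elements are identified with singletons. A hyperideal of $G$ is a non-empty $A\subseteq G$ with $x-y\in A$ for all $x,y\in A$ and $r\circ x\subseteq A$ for all $x\in A$, $r\in G$. A proper hyperideal $P$ is prime if $x\circ y\subseteq P$ ($x,y\in G$) implies $x\in P$ or $y\in P$. $\mathrm{rad}(A)$ is the intersection of all prime hyperideals containing $A$, and $\mathrm{rad}(A)=G$ if there are none. $A$ is a $\mathcal{C}$-hyperideal if for all $n\in\mathbb{N}$ and $a_1,\dots,a_n\in G$, $(a_1\circ\cdots\circ a_n)\cap A\neq\varnothing$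 implies $a_1\circ\cdots\circ a_n\subseteq A$. A multiplicative closed subset (MCS) of $G$ is a subset $S\subseteq G$ containing $1$ with $(s_1\circ s_2)\cap S\neq\varnothing$ for all $s_1,s_2\in S$. Let $A$ be a hyperideal with $A\cap S=\varnothing$. $A$ is $S$-prime if there is $t\in S$ such that for all $u,v\in G$, $u\circ v\subseteq A$ implies $t\circ u\subseteq A$ or $t\circ v\subseteq A$. $A$ is quasi $S$-primary if there is $t\in S$ such that for all $u,v\in G$, $u\circ v\subseteq A$ implies $t\circ u\subseteq \mathrm{rad}(A)$ or $t\circ v\subseteq\mathrm{rad}(A)$. *)

(* Defs.v *)
From HB Require Import structures.
From mathcomp Require Import all_boot all_order all_algebra.
From mathcomp Require Import boolp classical_sets.

Set Implicit Arguments.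
Unset Strict Implicit.
Unset Printing Implicit Defensive.

Import GRing.Theory.
Local Open Scope classical_set_scope.
Local Open Scope ring_scope.

Definition set_hmul (T : Type) (op : T -> T -> set T) (X Y : set T) : set T :=
  \bigcup_(x in X) \bigcup_(y in Y) op x y.

Definition set_add (V : zmodType) (X Y : set V) : set V :=
  [set x + y | x in X & y in Y].

Definition set_opp (V : zmodType) (X : set V) : set V := [set - x | x in X].

(* Commutative multiplicative hyperrings with a distinguished identity.
   Identities need not be unique (only [a \in 1 o a] is required), so [hone]
   is part of the structure. *)
HB.mixin Record isComMulHyperring G of GRing.Zmodule G := {
  hmul : G -> G -> set G;
  hone : G;
  hmul_nonempty : forall x y, hmul x y !=set0;
  hmulA : forall x y z,
    set_hmul hmul (hmul x y) [set z] = set_hmul hmul [set x] (hmul y z);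
  hmulNx : forall x y, hmul (- x) y = set_opp (hmul x y);
  hmulxN : forall x y, hmul x (- y) = set_opp (hmul x y);
  hmulDl : forall x y z, hmul (y + z) x `<=` set_add (hmul y x) (hmul z x);
  hmulDr : forall x y z, hmul x (y + z) `<=` set_add (hmul x y) (hmul x z);
  hmulC : forall x y, hmul x y = hmul y x;
  hmul1x : forall a, hmul hone a a
}.

#[short(type="comMulHyperringType")]
HB.structure Definition ComMulHyperring :=
  { G of GRing.Zmodule G & isComMulHyperring G }.

Section Hyperideals.
Variable G : comMulHyperringType.
Implicit Types (A P S : set G).

(* [hprod a [:: b1; ...; bk]] is the product [a o b1 o ... o bk] of k + 1
   factors; for k = 0 it is the singleton of [a]. *)
Definition hprod (a : G) (s : seq G) : set G :=
  foldl (fun X b => set_hmul hmul X [set b]) [set a] s.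

Definition hyperideal A : Prop :=
  [/\ A !=set0,
      forall x y, A x -> A y -> A (x - y)
    & forall r x, A x -> hmul r x `<=` A].

Definition prime_hyperideal P : Prop :=
  [/\ hyperideal P,
      P <> setT
    & forall x y, hmul x y `<=` P -> P x \/ P y].

(* The intersection of the empty family is [setT]. *)
Definition hyper_rad A : set G :=
  \bigcap_(P in [set P | prime_hyperideal P /\ A `<=` P]) P.

Definition C_hyperideal A : Prop :=
  hyperideal A /\
  forall (a : G) (s : seq G), hprod a s `&` A !=set0 -> hprod a s `<=` A.

Definition mult_closed S : Prop :=
  S hone /\ forall s1 s2, S s1 -> S s2 -> hmul s1 s2 `&` S !=set0.

Definition S_prime S A : Prop :=
  [/\ hyperideal A,
      A `&` S = set0
    & exists2 t, S t & forall u v, hmul u v `<=` A ->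
        hmul t u `<=` A \/ hmul t v `<=` A].

Definition quasi_S_primary S A : Prop :=
  [/\ hyperideal A,
      A `&` S = set0
    & exists2 t, S t & forall u v, hmul u v `<=` A ->
        hmul t u `<=` hyper_rad A \/ hmul t v `<=` hyper_rad A].

End Hyperideals.

(* Main.v *)
Require Import Defs.
From mathcomp Require Import all_boot all_order all_algebra.
From mathcomp Require Import boolp classical_sets.

(** A quasi [S]-primary [A] and an [S]-prime [hyper_rad A] can share the same
    witness [t].  From the radical to [A] this is just [A `<=` hyper_rad A].

    For the converse, let [u o v `<=` rad A].  By Krull's separation lemma
    ([prime_avoiding]), a hyperideal disjoint from a multiplicatively closed
    set [M] lies in a prime hyperideal disjoint from [M].  Applied to the union
    of all the [u^n o v^n], it shows that some [u^n o v^n] meets [A]: otherwise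
    a prime hyperideal over [A] would miss [u o v], which is nonempty and lies
    in [rad A] ([hpow_mul_meets]).  As [A] is a C-hyperideal, that product is
    then contained in [A], so every [a] in [u^n] and [b] in [v^n] satisfy
    [a o b `<=` A].  Quasi [S]-primarity gives [t o a `<=` rad A] or
    [t o b `<=` rad A] for each such pair, hence one of the two alternatives
    holds uniformly: [t o a `<=` rad A] for all [a] in [u^n], or the same for
    all [b] in [v^n].  A prime hyperideal over [A] which does not contain [t]
    then contains [u^n] (say), hence [u]; so [t o u] lies in every such prime
    ([hmul_pow_sub_rad]).  Finally, separating [A] from [S] itself shows that
    [rad A] does not meet [S]. *)

Set Implicit Arguments.
Unset Strict Implicit.
Unset Printing Implicit Defensive.

Import GRing.Theory.
Local Open Scope classical_set_scope.
Local Open Scope ring_scope.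

Section Hyperring.
Variable G : comMulHyperringType.
Implicit Types (A P M S X Y Z : set G) (u v x y : G).

Local Notation smul := (set_hmul (@hmul G)).

Lemma smulP X Y z :
  smul X Y z <-> exists x y, [/\ X x, Y y & hmul x y z].
Proof.
split; first by case=> x Xx [y Yy xyz]; exists x, y.
by case=> x [y [Xx Yy xyz]]; exists x => //; exists y.
Qed.

Lemma smul11 x y : smul [set x] [set y] = hmul x y.
Proof. by rewrite /set_hmul !bigcup_set1. Qed.

Lemma smulC X Y : smul X Y = smul Y X.
Proof.
by apply/seteqP; split=> z /smulP[x [y [? ? ?]]]; apply/smulP; exists y, x;
  rewrite hmulC.
Qed.

Lemma smulA X Y Z : smul (smul X Y) Z = smul X (smul Y Z).
Proof.
apply/seteqP; split=> w /smulP[].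
- move=> p [z [/smulP[x [y [Xx Yy xyp]]] Zz pzw]].
  have : smul (hmul x y) [set z] w by apply/smulP; exists p, z.
  rewrite hmulA => /smulP[_ [q [-> yzq xqw]]].
  by apply/smulP; exists x, q; split=> //; apply/smulP; exists y, z.
- move=> x [q [Xx /smulP[y [z [Yy Zz yzq]]] xqw]].
  have : smul [set x] (hmul y z) w by apply/smulP; exists x, q.
  rewrite -hmulA => /smulP[p [_ [xyp -> pzw]]].
  by apply/smulP; exists p, z; split=> //; apply/smulP; exists x, y.
Qed.

Lemma smulACA X Y Z W :
  smul (smul X Y) (smul Z W) = smul (smul X Z) (smul Y W).
Proof. by rewrite !smulA -(smulA Y) (smulC Y Z) smulA. Qed.

Lemma smul_nonempty X Y : X !=set0 -> Y !=set0 -> smul X Y !=set0.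
Proof.
move=> [x Xx] [y Yy]; have [z xyz] := @hmul_nonempty G x y.
by exists z; apply/smulP; exists x, y.
Qed.

Lemma hprod_cat (a b : G) (s r : seq G) :
  hprod a (s ++ b :: r) = smul (hprod a s) (hprod b r).
Proof.
elim/last_ind: r => [|r c IHr]; first by rewrite cats1 /hprod foldl_rcons.
rewrite -rcons_cons -rcons_cat.
have hprod_rcons d q : hprod d (rcons q c) = smul (hprod d q) [set c].
  by rewrite /hprod foldl_rcons.
by rewrite !hprod_rcons IHr smulA.
Qed.

(** The power [u^(n+1)]: the shift keeps it a nonempty product, the unit
    being only a weak identity: [1 o u] may be larger than [u]. *)
Definition hpow u n : set G := hprod u (nseq n u).

Lemma hpowD u m n : smul (hpow u m) (hpow u n) = hpow u (m + n).+1.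
Proof. by rewrite -hprod_cat /hpow -[u :: _]/(nseq n.+1 u) -nseqD addnS. Qed.

Lemma hpowS u n : hpow u n.+1 = smul (hpow u n) [set u].
Proof. by rewrite -[n in LHS]addn0 -hpowD. Qed.

Lemma hpow_nonempty u n : hpow u n !=set0.
Proof.
elim: n => [|n IHn]; first by exists u.
by rewrite hpowS; apply: smul_nonempty => //; exists u.
Qed.

Lemma hyperideal0 A : hyperideal A -> A 0.
Proof. by case=> [[x Ax] AB _]; rewrite -(subrr x); apply: AB. Qed.

(** The colon hyperideal [(P : y)].  It replaces the hyperideal generated by
    [P] and an element in the proof of Krull's lemma, and so spares the
    description of generated hyperideals by finite sums of products. *)
Definition colon P y : set G := [set z | hmul z y `<=` P].

Lemma colon_hyperideal P y : hyperideal P -> hyperideal (colon P y).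
Proof.
move=> hP; have [_ PB PM] := hP; split.
- by exists 0 => z; rewrite hmulC => /PM; apply; exact: hyperideal0.
- move=> a b /= aP bP z /hmulDl[p ayp [q byq <-]].
  move: byq; rewrite hmulNx => -[r byr <-].
  by apply: PB; [exact: aP | exact: bP].
- move=> r x /= xP w rxw z wyz.
  have : smul (hmul r x) [set y] z by apply/smulP; exists w, y.
  by rewrite hmulA => /smulP[_ [p [-> /xP Pp]]]; exact: PM.
Qed.

Lemma sub_colon P y : hyperideal P -> P `<=` colon P y.
Proof. by case=> _ _ PM x Px z; rewrite hmulC; exact: PM. Qed.

(** Krull's separation lemma, whose prime is a maximal hyperideal [P] among
    those that contain [A] and miss [M].  If [x o y `<=` P] with neither factor
    in [P], maximality applied to [(P : y)], which contains [x], gives [m] in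
    [M] with [m o y `<=` P]; applied to [(P : m)], which contains [y], it gives
    [m'] in [M] with [m' o m `<=` P], although [m' o m] meets [M]. *)
Lemma prime_avoiding A M : hyperideal A -> M !=set0 ->
    (forall x y, M x -> M y -> hmul x y `&` M !=set0) -> A `&` M = set0 ->
  exists P, [/\ prime_hyperideal P, A `<=` P & P `&` M = set0].
Proof.
move=> hA [m0 Mm0] closedM AM0.
(* Zorn's lemma includes the empty chain, whose union is empty, so the order
   is on the sets to be added to A. *)
pose good X := hyperideal (A `|` X) /\ (A `|` X) `&` M = set0.
have [F goodF totF|X [[hP PM0] Xmax]] := Zorn_bigcup (P := good).
  have [_ AB AM] := hA; split.
    split.
    - by exists 0; left; exact: hyperideal0.
    - move=> x y.
      have stage X : F X -> (A `|` X) x -> (A `|` X) y ->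
          (A `|` \bigcup_(Y in F) Y) (x - y).
        move=> FX Xx Xy; have [[_ XB _] _] := goodF X FX.
        by case: (XB x y Xx Xy) => ?; [left | right; exists X].
      case=> [Ax|[X FX Xx]] [Ay|[Y FY Yy]].
      + by left; exact: AB.
      + by apply: (stage Y) => //; [left | right].
      + by apply: (stage X) => //; [right | left].
      + have [XY|YX] := totF X Y FX FY.
        * by apply: (stage Y) => //; right => //; exact: XY.
        * by apply: (stage X) => //; right => //; exact: YX.
    - move=> r x [Ax|[X FX Xx]] z rxz; first by left; exact: AM rxz.
      have [[_ _ XM] _] := goodF X FX.
      by case: (XM r x (or_intror Xx) z rxz) => ?; [left | right; exists X].
  rewrite -subset0 => x [[Ax|[X FX Xx]] Mx]; first by rewrite -AM0.
  have [_ XM0] := goodF X FX.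
  by rewrite -XM0; split=> //; right.
set P := A `|` X in hP PM0.
have AP : A `<=` P by move=> x; left.
have P_max Q z : hyperideal Q -> P `<=` Q -> Q z -> ~ P z ->
    exists2 m, M m & Q m.
  move=> hQ PQ Qz nPz; apply: contrapT => noM.
  have AQ : A `|` Q = Q by apply/setUidPr => x /AP/PQ.
  apply: (Xmax Q).
    split=> [x Xx|QX]; first by apply: PQ; right.
    by apply: nPz; right; exact: QX.
  split; rewrite AQ // -subset0 => m [Qm Mm].
  by apply: noM; exists m.
have P_M m : P m -> ~ M m by move=> Pm Mm; have : (P `&` M) m by []; rewrite PM0.
exists P; split=> //; split=> //.
  by move=> PT; apply: (P_M m0); rewrite ?PT.
move=> x y xyP; apply: contrapT => /not_orP[nPx nPy].
have [m Mm myP] := P_max _ x (colon_hyperideal y hP) (sub_colon (y := y) hP)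
  xyP nPx.
have ymP : colon P m y by rewrite /colon /= hmulC.
have [m' Mm' mmP] := P_max _ y (colon_hyperideal m hP) (sub_colon (y := m) hP)
  ymP nPy.
have [z [mmz Mz]] := closedM m' m Mm' Mm.
exact: P_M (mmP z mmz) Mz.
Qed.

Lemma sub_hyper_rad A : A `<=` hyper_rad A.
Proof. by move=> x Ax P [_]; apply. Qed.

Lemma hyper_rad_hyperideal A : hyperideal (hyper_rad A).
Proof.
split.
- by exists 0 => P [[hP _ _] _]; exact: hyperideal0.
- move=> x y Ax Ay P AP; have [[[_ PB _] _ _] _] := AP.
  by apply: PB; [exact: Ax | exact: Ay].
- move=> r x Ax z rxz P AP; have [[[_ _ PM] _ _] _] := AP.
  by apply: PM rxz; exact: Ax.
Qed.

Lemma hyper_rad_avoids A S : hyperideal A -> mult_closed S ->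
  A `&` S = set0 -> hyper_rad A `&` S = set0.
Proof.
move=> hA [S1 SM] AS0; rewrite -subset0 => s [As Ss].
have [P [pP AP <-]] := prime_avoiding hA (ex_intro _ _ S1) SM AS0.
by split=> //; exact: As.
Qed.

Lemma prime_hpow P u n : prime_hyperideal P -> hpow u n `<=` P -> P u.
Proof.
move=> [_ _ pP]; elim: n => [|n IHn] unP; first exact: unP.
apply: contrapT => nPu; apply/nPu/IHn => b unb.
case: (pP b u) => // z buz.
by apply: unP; rewrite hpowS; apply/smulP; exists b, u.
Qed.

(** Checked prime by prime: a prime hyperideal over [A] contains [t], or else
    it contains every [a] in [u^n] and hence [u]. *)
Lemma hmul_pow_sub_rad A t u n :
    (forall a, hpow u n a -> hmul t a `<=` hyper_rad A) ->
  hmul t u `<=` hyper_rad A.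
Proof.
move=> tuA z tuz P AP; have [pP _] := AP; have [[_ _ PM] _ primeP] := pP.
have [Pt|nPt] := pselect (P t).
  by move: tuz; rewrite hmulC; exact: PM.
suff Pu : P u by exact: PM tuz.
apply: (prime_hpow (n := n) pP) => a una.
by case: (primeP t a) => // w taw; exact: (tuA a una w taw P AP).
Qed.

(** The union of the [u^n o v^n] is multiplicatively closed, since products of
    powers can be regrouped.  Were it disjoint from [A], a prime hyperideal over
    [A] would avoid it, in particular its part [u o v], which is nonempty and
    lies in every such prime. *)
Lemma hpow_mul_meets A u v : hyperideal A -> hmul u v `<=` hyper_rad A ->
  exists n, smul (hpow u n) (hpow v n) `&` A !=set0.
Proof.
move=> hA uvA; apply: contrapT => noA.
pose M := \bigcup_n smul (hpow u n) (hpow v n).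
have uvM : hmul u v `<=` M by move=> z uvz; exists 0%N; rewrite ?smul11.
have [w uvw] := @hmul_nonempty G u v.
have [||||P [pP AP PM0]] := @prime_avoiding A M => //.
- by exists w; exact: uvM.
- move=> x y [m _ xM] [n _ yM]; have [z xyz] := @hmul_nonempty G x y.
  exists z; split=> //; exists (m + n).+1 => //.
  by rewrite -!hpowD smulACA; apply/smulP; exists x, y.
- rewrite -subset0 => x [Ax [n _ xM]].
  by apply: noA; exists n, x.
- have : (P `&` M) w by split; [exact: (uvA w uvw P) | exact: uvM].
  by rewrite PM0.
Qed.

(** The product [u^n o v^n] is that of a single list of elements, which is the
    form to which the C-property applies. *)
Lemma C_hpow_mul_sub A u v : C_hyperideal A -> hmul u v `<=` hyper_rad A ->
  exists n, smul (hpow u n) (hpow v n) `<=` A.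
Proof.
move=> [hA CA] /(hpow_mul_meets hA)[n].
by rewrite -hprod_cat => /CA ?; exists n; rewrite -hprod_cat.
Qed.

End Hyperring.

Theorem theorem2p4 (G : comMulHyperringType) (A S : set G)
    (hA : C_hyperideal A) (hS : mult_closed S) (hAS : A `&` S = set0) :
  quasi_S_primary S A <-> S_prime S (hyper_rad A).
Proof.
have [hypA _] := hA; split; case=> _ _ [t St tP].
- split; [exact: hyper_rad_hyperideal | exact: hyper_rad_avoids |].
  exists t => // u v /(C_hpow_mul_sub hA)[n uvA].
  have [uP|nuP] := pselect (forall a, hpow u n a -> hmul t a `<=` hyper_rad A).
    by left; exact: hmul_pow_sub_rad uP.
  right; apply: (hmul_pow_sub_rad (n := n)) => b vb.
  (* One a in u^n violating the first alternative forces the second for all b. *)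
  apply: contrapT => nbP; apply: nuP => a ua.
  by case: (tP a b) => // z abz; apply: uvA; apply/smulP; exists a, b.
- split=> //; exists t => // u v uvA; apply: tP.
  exact: subset_trans uvA (@sub_hyper_rad G A).
Qed.
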